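(* Let $n\geq 2$ be an integer, let $L_{2,n}=L_2\times L_n$ be the product of a $2$-element chain and an $n$-element chain, let $k$ be a field, $S_n=k[y_1,\ldots,y_{3n-2}]$ and $T_n=k[x_1,\ldots,x_{2n}]$, with $I_{\mathrm{LD}}(L_{2,n})\subseteq S_n$ and $I_{n+1}(L_{2,n})\subseteq T_n$. Then: (i) $\operatorname{height}(I_{\mathrm{LD}}(L_{2,n}))=2$ and $\operatorname{height}(I_{n+1}(L_{2,n}))=1$; (ii) $\dim(S_n/I_{\mathrm{LD}}(L_{2,n}))=3n-4$ and $\dim(T_n/I_{n+1}(L_{2,n}))=2n-1$.
   Context: $L_{2,n}$ has elements $(i,s)$ with $i\in\{0,1\}$, $0\leq s\leq n-1$, ordered by $(i,s)\leq (j,t)$ iff $i\leq j$ and $s\leq t$. Its $2n$ elements are identified with $x_1,\ldots,x_{2n}$ and its $3n-2$ cover relations (edges of the Hasse diagram) with $y_1,\ldots,y_{3n-2}$. $I_{\mathrm{LD}}(L_{2,n})\subseteq S_n$ is the ideal generated by the monomials $\prod_{e\in\pi}y_e$, where $\pi$ runs over the maximal saturated chains of $L_{2,n}$ and the product is over the cover relations (edges) of $\pi$. $I_{n+1}(L_{2,n})\subseteq T_n$ is the path ideal generated by the monomials $\prod_{v\in\pi}x_v$, where $\pi$ runs over the saturated chains with $n+1$ elements (these are the maximal chains) and the product is over the elements of $\pi$. $\dim$ is Krull dimension. *)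

(* Defs.v *)
From HB Require Import structures.
From mathcomp Require Import all_boot all_order all_algebra.
From mathcomp Require Import ring_quotient.
From mathcomp Require Import mpoly.
From mathcomp Require Import boolp.
From mathcomp Require Import zify.

Set Implicit Arguments.
Unset Strict Implicit.
Unset Printing Implicit Defensive.

Import Order.TTheory GRing.Theory.
Local Open Scope ring_scope.

(** * Prime ideals, height and Krull dimension

    Subsets of a ring are boolean predicates; since [asbool] turns every
    proposition into a boolean, no subset is lost. *)

Section Dimension.
Variable R : comNzRingType.
Implicit Types (I P : {pred R}) (C : nat -> {pred R}) (d h : nat).

Definition prime_ideal P : Prop := idealr_closed P /\ prime_idealr_closed P.

(* C 0, ..., C d are prime ideals with C 0 < ... < C d (length d); the values
   of C beyond d are irrelevant *)
Definition prime_chain d C : Prop :=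
  (forall i, (i <= d)%N -> prime_ideal (C i)) /\
  (forall i, (i < d)%N ->
     {subset C i <= C i.+1} /\ ~ {subset C i.+1 <= C i}).

(* "dim R = d" *)
Definition krull_dim d : Prop :=
  (exists C, prime_chain d C) /\
  (forall d' C, prime_chain d' C -> (d' <= d)%N).

(* "height P = h" for a prime ideal P *)
Definition prime_height P h : Prop :=
  (exists C, prime_chain h C /\ C h =i P) /\
  (forall h' C, prime_chain h' C -> C h' =i P -> (h' <= h)%N).

(* "height I = h": the minimum of the heights of the primes containing I.  A
   prime of infinite height satisfies no [prime_height P h'] and so does not
   affect the minimum. *)
Definition ideal_height I h : Prop :=
  (exists P, [/\ prime_ideal P, {subset I <= P} & prime_height P h]) /\
  (forall P h', prime_ideal P -> {subset I <= P} -> prime_height P h' ->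
     (h <= h')%N).

End Dimension.

Arguments krull_dim R d : clear implicits.

(** * Ideal generated by a set, and quotient by it *)

Section IdealGen.
Variable R : comNzRingType.
Implicit Type G : R -> Prop.

Definition ideal_gen G : {pred R} := fun f =>
  `[< exists s : seq (R * R), (forall p, p \in s -> G p.2) /\
        f = \sum_(p <- s) p.1 * p.2 >].

Lemma ideal_genP G f :
  reflect (exists s : seq (R * R), (forall p, p \in s -> G p.2) /\
             f = \sum_(p <- s) p.1 * p.2)
          (f \in ideal_gen G).
Proof. exact: asboolP. Qed.

Lemma ideal_gen_closed G :
  1 \notin ideal_gen G -> idealr_closed (ideal_gen G).
Proof.
move=> n1; split=> //.
  by apply/ideal_genP; exists [::]; split=> [p|]; rewrite ?in_nil ?big_nil.
move=> a _ _ /ideal_genP[s [Gs ->]] /ideal_genP[t [Gt ->]]; apply/ideal_genP.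
exists ([seq (a * p.1, p.2) | p <- s] ++ t); split.
  move=> p; rewrite mem_cat => /orP[/mapP[q qs ->]|pt]; [exact: (Gs q)|exact: Gt].
rewrite big_cat big_map big_distrr /=; congr (_ + _).
by apply: eq_bigr => p _; rewrite mulrA.
Qed.

(* the library only forms ring quotients by proper ideals *)
Definition ideal_gen_idealr G (n1 : 1 \notin ideal_gen G) : idealr R :=
  HB.pack (ideal_gen G : R -> bool)
    (isIdealr.Build R (ideal_gen G) (ideal_gen_closed n1)).

End IdealGen.

(** * Chains of a finite poset, and their ideals *)

Section Poset.
Variables (d : Order.disp_t) (T : finPOrderType d).
Implicit Type s : seq T.

Definition covers (u v : T) : bool :=
  (u < v)%O && [forall w : T, ~~ ((u < w)%O && (w < v)%O)].

Definition edge : finType := {e : T * T | covers e.1 e.2}.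

Definition saturated_chain s : bool := sorted covers s.

Definition maximal_saturated_chain s : Prop :=
  saturated_chain s /\
  (forall t, saturated_chain t -> {subset s <= t} -> {subset t <= s}).

Definition chain_edges s : seq (T * T) := zip s (behead s).

Variable k : fieldType.

(* y is the numbering of the edges by the variables *)
Definition LD_gens m (y : edge -> 'I_m) (f : {mpoly k[m]}) : Prop :=
  exists s, maximal_saturated_chain s /\
    f = \prod_(e : edge | val e \in chain_edges s) 'X_(y e).

Definition ideal_LD m (y : edge -> 'I_m) : {pred {mpoly k[m]}} :=
  ideal_gen (@LD_gens m y).

(* x is the numbering of the elements by the variables, r the number of
   elements of the chains *)
Definition path_gens r m (x : T -> 'I_m) (f : {mpoly k[m]}) : Prop :=
  exists s, [/\ saturated_chain s, size s = r & f = \prod_(v in s) 'X_(x v)].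

Definition path_ideal r m (x : T -> 'I_m) : {pred {mpoly k[m]}} :=
  ideal_gen (@path_gens r m x).

End Poset.

Arguments LD_gens {d T} k {m} y f.
Arguments ideal_LD {d T} k {m} y _.
Arguments path_gens {d T} k r {m} x f.
Arguments path_ideal {d T} k r {m} x _.

(** * The poset L_{2,n}

    [*p] carries the componentwise order.  [card_L2] and [card_edge_L2] ensure
    that bijections of its elements with ['I_(2 * n)], and of its edges with
    ['I_(3 * n - 2)], exist. *)

Definition L2 (n : nat) := ('I_2 *p 'I_n)%type.

Lemma L2_leE n (u v : L2 n) : (u <= v)%O = (u.1 <= v.1)%N && (u.2 <= v.2)%N.
Proof. by rewrite Order.ProdOrder.leEprod !leEord. Qed.

Lemma L2_ltE n (u v : L2 n) :
  (u < v)%O = [&& (u.1 <= v.1)%N, (u.2 <= v.2)%N & (u.1 + u.2 < v.1 + v.2)%N].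
Proof.
rewrite lt_neqAle L2_leE; case: u v => [i s] [j t] /=.
rewrite xpair_eqE -!val_eqE /=; lia.
Qed.

Lemma L2_coversE n (u v : L2 n) : covers u v =
  (u.1 == v.1) && (v.2 == u.2.+1 :> nat) ||
  (v.1 == u.1.+1 :> nat) && (u.2 == v.2).
Proof.
case: u v => [i s] [j t] /=; rewrite -!val_eqE /=.
apply/andP/idP; rewrite L2_ltE /=.
  move=> [uv /forallP cov].
  have := ltn_ord t; have := ltn_ord j; have := ltn_ord i => i2 j2 tn.
  have := cov (i, t); rewrite !L2_ltE /=.
  case: (ltnP s.+1 t) => [st|ts]; last lia.
  by have := cov (i, Ordinal (ltn_trans st tn)); rewrite !L2_ltE /=; lia.
move=> h; split; first lia.
by apply/forallP => -[l r]; rewrite !L2_ltE /=; lia.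
Qed.

Lemma card_edge_L2 n : #|{: edge (L2 n)}| = (3 * n - 2)%N.
Proof.
have sum_eq : (\sum_(s < n) \sum_(t < n) (s == t) = n)%N.
  rewrite (eq_bigr (fun=> 1%N)) => [|s _].
    by rewrite sum_nat_const card_ord muln1.
  by rewrite (bigD1 s) //= eqxx big1 // => t /negPf ts; rewrite eq_sym ts.
have sum_succ m :
    (\sum_(s < m) \sum_(t < m) (t == s.+1 :> nat) = m.-1)%N.
  case: m => [|m]; first by rewrite big_ord0.
  rewrite big_ord_recr /= [X in (_ + X)%N]big1 => [|t _]; last first.
    by have := ltn_ord t; case: eqP => // ->; rewrite ltnn.
  rewrite addn0 (eq_bigr (fun=> 1%N)) => [|s _].
    by rewrite sum_nat_const card_ord muln1.
  rewrite (bigD1 (lift ord0 s)) //= eqxx big1 ?addn0 // => t.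
  by rewrite -val_eqE /= => /negPf->.
pose F i s j t := ((i == j) * (t == s.+1) + (j == i.+1) * (s == t))%N.
have coversE (e : L2 n * L2 n) :
    (covers e.1 e.2 : nat) = F e.1.1 e.1.2 e.2.1 e.2.2.
  rewrite L2_coversE /F; case: e => -[i s] [j t] /=; rewrite -!val_eqE /=; lia.
rewrite card_sig -sum1_card big_mkcond /=.
transitivity
    (\sum_(i < 2) \sum_(s < n) \sum_(j < 2) \sum_(t < n) F i s j t)%N.
  rewrite pair_bigA /= -(pair_bigA _ (fun u v : L2 n =>
    if (u, v) \in [pred e | covers e.1 e.2] then 1%N else 0%N)) /=.
  apply: eq_bigr => u _; rewrite pair_bigA; apply: eq_bigr => v _.
  by rewrite -(coversE (u, v)) inE; case: covers.
have row (i : 'I_2) :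
    (\sum_(s < n) \sum_(j < 2) \sum_(t < n) F i s j t
       = n.-1 + (i == 0%N :> nat) * n)%N.
  rewrite -(sum_succ n) -[X in (_ * X)%N]sum_eq big_distrr -big_split /=.
  apply: eq_bigr => s _; rewrite big_distrr -big_split exchange_big /=.
  apply: eq_bigr => t _; rewrite !big_ord_recl big_ord0 /F -val_eqE /=.
  by have := ltn_ord i; rewrite /bump /=; case: (val i) => [|[|]] //= _; lia.
rewrite !big_ord_recl big_ord0 !row /=; lia.
Qed.

Lemma card_L2 n : #|{: L2 n}| = (2 * n)%N.
Proof. by rewrite card_prod !card_ord. Qed.

Section Properness.
Variables (k : fieldType) (n : nat).

Lemma ideal_gen_proper m (G : {mpoly k[m]} -> Prop) :
  (forall f, G f -> f.@[fun=> 0] = 0) -> 1 \notin ideal_gen G.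
Proof.
move=> G0; apply/negP => /ideal_genP[s [Gs e1]].
have /eqP := congr1 (meval (fun=> (0 : k))) e1.
rewrite meval1 rmorph_sum big_seq big1 ?oner_eq0 //= => p ps.
by rewrite mevalM (G0 _ (Gs _ ps)) mulr0.
Qed.

Lemma path_ideal_proper (x : L2 n -> 'I_(2 * n)) :
  1 \notin path_ideal k n.+1 x.
Proof.
apply: ideal_gen_proper => f [[|v s] [_ // _ ->]].
by rewrite rmorph_prod (bigD1 v) ?mem_head //= mevalXU mul0r.
Qed.

Lemma ideal_LD_proper (y : edge (L2 n) -> 'I_(3 * n - 2)) : (1 < n)%N ->
  1 \notin ideal_LD k y.
Proof.
move=> n1; apply: ideal_gen_proper => f [s [[sat max] ->]].
case: s sat max => [|a [|b s]] /= sat max.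
- pose a : L2 n := (ord0, Ordinal (ltnW n1)).
  have sub0 : {subset [::] <= [:: a]} by move=> v; rewrite in_nil.
  by have := max [:: a] isT sub0 a (mem_head _ _).
- pose b : L2 n := (rev_ord a.1, a.2).
  have ba : b \notin [:: a].
    rewrite inE; case: a @b {max} => i t /=; rewrite xpair_eqE -!val_eqE /=.
    by have := ltn_ord i; lia.
  suff [t [tsat ta tb]] : exists t, [/\ saturated_chain t, a \in t & b \in t].
    have sub_at : {subset [:: a] <= t} by move=> v; rewrite inE => /eqP->.
    by case/negP: ba; apply: max tb.
  have /orP[ab|ba'] : covers a b || covers b a.
    rewrite !L2_coversE; case: a @b {max ba} => i t /=; rewrite -!val_eqE /=.
    by have := ltn_ord i; lia.
  + by exists [:: a; b]; rewrite /saturated_chain /= ab !inE !eqxx orbT.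
  + by exists [:: b; a]; rewrite /saturated_chain /= ba' !inE !eqxx orbT.
- have [ab _] := andP sat.
  pose e : edge (L2 n) := Sub (a, b) ab.
  by rewrite rmorph_prod (bigD1 e) ?mem_head //= mevalXU mul0r.
Qed.

End Properness.

(* Main.v *)
Require Import Defs.
From HB Require Import structures.
From mathcomp Require Import all_boot all_order all_algebra.
From mathcomp Require Import ring_quotient.
From mathcomp Require Import mpoly.
From mathcomp Require Import boolp zify ring.

Set Implicit Arguments.
Unset Strict Implicit.
Unset Printing Implicit Defensive.

Import Order.TTheory GRing.Theory.
Local Open Scope ring_scope.

(** Both dimensions reduce to the bound [d <= m] on the length [d] of a chain of
    primes in [k[X_1, ..., X_m]].  Such a chain yields [d] algebraically
    independent polynomials, and more than [m] polynomials are dependent by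
    counting monomials.

    Say that an ideal [I] lies in the prime generated by [h] variables, and that
    every prime containing [I] contains [h] variables.  A chain of primes above
    [I] can then be lengthened by [h] steps at the bottom, and a chain ending at
    the prime of the [h] variables by [m - h] steps at the top, so [I] has height
    [h] and its quotient has dimension [m - h].

    For the path ideal [h = 1], as all maximal chains contain the bottom element;
    for the edge ideal [h = 2], as every maximal chain starts with one of the two
    edges at the bottom and some two maximal chains share no edge. *)

(** * Elementary facts on prime ideals, and concatenation of chains of primes *)

Section PrimeIdeals.
Variables (R : comNzRingType) (P : {pred R}).
Hypothesis primeP : prime_ideal P.

Lemma prime_ideal0 : 0 \in P. Proof. by case: primeP => -[]. Qed.

Lemma prime_idealN1 : 1 \notin P. Proof. by case: primeP => -[]. Qed.

Lemma prime_idealD u v : u \in P -> v \in P -> u + v \in P.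
Proof. by case: primeP => -[_ _ Pl] _ uP vP; rewrite -[u]mul1r Pl. Qed.

Lemma prime_idealMr a u : u \in P -> a * u \in P.
Proof.
by case: primeP => -[P0 _ Pl] _ uP; rewrite -[_ * _]addr0 Pl.
Qed.

Lemma prime_idealDr u v : u \in P -> (v + u \in P) = (v \in P).
Proof.
move=> uP; apply/idP/idP => vP; last exact: prime_idealD.
by rewrite -(addrK u v) -mulN1r addrC -[v + u]mul1r addrC prime_idealD
  ?mul1r ?prime_idealMr.
Qed.

Lemma prime_idealM u v : u * v \in P -> u \in P \/ v \in P.
Proof. by case: primeP => _ Pp /Pp/orP. Qed.

Lemma prime_ideal_prod (I : finType) (A : pred I) (F : I -> R) :
  \prod_(i | A i) F i \in P -> exists2 i, A i & F i \in P.
Proof.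
elim/big_rec: _ => [P1|i x Ai IH /prime_idealM[iP|/IH//]]; last by exists i.
by have := prime_idealN1; rewrite P1.
Qed.

End PrimeIdeals.

Lemma prime_chain0 (R : comNzRingType) (P : {pred R}) :
  prime_ideal P -> prime_chain 0 (fun=> P).
Proof. by []. Qed.

(** [C1 d] is dropped in favour of [C2 0], so that lengths add up under a mere inclusion of the
    former in the latter, equality being allowed. *)
Definition cat_chain (R : comNzRingType) d (C1 C2 : nat -> {pred R}) i :=
  if (i < d)%N then C1 i else C2 (i - d)%N.

Lemma cat_chainP (R : comNzRingType) d1 d2 (C1 C2 : nat -> {pred R}) :
  prime_chain d1 C1 -> prime_chain d2 C2 -> {subset C1 d1 <= C2 0%N} ->
  prime_chain (d1 + d2) (cat_chain d1 C1 C2).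
Proof.
move=> [p1 s1] [p2 s2] s12; split=> i id12; rewrite /cat_chain.
  by case: ltnP => id1; [apply: p1; exact: ltnW | apply: p2; lia].
case: (ltnP i d1) => id1; last first.
  by rewrite ltnNge (leq_trans id1) //= subSn //; apply: s2; lia.
case: ltnP => id1'; first exact: s1.
have e : i.+1 = d1 by lia.
rewrite e subnn; have [s1i ns1i] := s1 _ id1; rewrite e in s1i ns1i.
split=> [f /s1i/s12 //|s21]; apply: ns1i => f /s12; exact: s21.
Qed.

Lemma cat_chain_last (R : comNzRingType) d1 d2 (C1 C2 : nat -> {pred R}) :
  cat_chain d1 C1 C2 (d1 + d2) = C2 d2.
Proof. by rewrite /cat_chain ltnNge leq_addr addKn. Qed.

(** * From chains of primes to algebraically independent elements *)

Section AlgebraicIndependence.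
Variables (k : fieldType) (R : comNzRingType) (f : {rmorphism k -> R}).

(** [muni] singles out the last variable, so the other variables can be evaluated first; this serves
    the induction on the number of variables. *)
Lemma mmap_muni n (h : 'I_n.+1 -> R) (F : {mpoly k[n.+1]}) :
  mmap f h F =
  (map_poly (mmap f (fun i => h (widen_ord (leqnSn n) i))) (muni F)).[h ord_max].
Proof.
rewrite muniE rmorph_sum horner_sum {1}/mmap; apply: eq_bigr => m _ /=.
rewrite map_polyZ map_polyXn hornerZ hornerXn /= mmapZ mmapX /mmap1.
by rewrite big_ord_recr /= mulrA; under [in RHS]eq_bigr do rewrite mnmE.
Qed.

End AlgebraicIndependence.

Lemma mmap_mpolyX (k : fieldType) n (F : {mpoly k[n]}) :
  mmap (@mpolyC n k) (fun i => 'X_i) F = F.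
Proof.
rewrite [RHS]mpolyE /mmap; apply: eq_bigr => m _.
by rewrite mmap1_id mul_mpolyC.
Qed.

(** Substituting the variables for themselves in [mmap_muni] recovers [F] from [muni F]. *)
Lemma muni_eq0 (k : fieldType) n (F : {mpoly k[n.+1]}) : muni F = 0 -> F = 0.
Proof.
by move=> F0; rewrite -(mmap_mpolyX F) mmap_muni F0 rmorph0 horner0.
Qed.

Section ChainIndependence.
Variables (k : fieldType) (R : comNzRingType) (f : {rmorphism k -> R}).

(* Write [F] as [p * 'X + c] in the last variable.  A value of [F] in [P] puts
   the value of [c] in [Q], as [a r] is in [Q]; once [c = 0], the factor [a r]
   cancels mod [P]. *)
Lemma alg_indep_step r (a : nat -> R) (P Q : {pred R}) :
    prime_ideal P -> prime_ideal Q -> {subset P <= Q} ->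
    a r \in Q -> a r \notin P ->
    (forall F : {mpoly k[r]},
       mmap f (fun i : 'I_r => a i) F \in Q -> F = 0) ->
  forall F : {mpoly k[r.+1]},
    mmap f (fun i : 'I_r.+1 => a i) F \in P -> F = 0.
Proof.
move=> pP pQ sPQ aQ aP indQ F FP; apply: muni_eq0; move: FP.
rewrite mmap_muni; elim/poly_ind: (muni F) => //= p c IH.
rewrite rmorphD rmorphM /= map_polyX map_polyC /= hornerMXaddC => pP'.
have c0 : c = 0.
  apply: indQ; have := sPQ _ pP'.
  by rewrite addrC (prime_idealDr pQ _ (prime_idealMr pQ _ aQ)).
move: pP'; rewrite c0 rmorph0 addr0 => /(prime_idealM pP)[/IH->|].
  by rewrite mul0r add0r.
by rewrite (negPf aP).
Qed.

Lemma prime_chain_alg_indep d (C : nat -> {pred R}) : prime_chain d C ->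
  exists a : nat -> R, forall F : {mpoly k[d]},
    mmap f (fun i : 'I_d => a i) F \in C 0%N -> F = 0.
Proof.
move=> [pC sC].
have /choice[b bP] i : exists x, (i < d)%N -> x \in C i.+1 /\ x \notin C i.
  have [id|] := boolP (i < d)%N; last by exists 0.
  have [_ /existsNP[x /not_implyP[xC /negP nxC]]] := sC _ id.
  by exists x.
(* Numbered from the top of the chain down, the element of index [r] lies in [C (d - r)] but not in
   [C (d - r.+1)], as [alg_indep_step] requires. *)
exists (fun i => b (d - i.+1)%N).
suff ind r : (r <= d)%N -> forall F : {mpoly k[r]},
    mmap f (fun i : 'I_r => b (d - i.+1)%N) F \in C (d - r)%N -> F = 0.
  by have := ind d (leqnn d); rewrite subnn.
elim: r => [|r IH] rd.
  move=> F; rewrite subn0.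
  (* Without variables [F] is a constant; a nonzero constant maps to a unit, which no prime
     contains. *)
  have -> : F = (F@_0%MM)%:MP.
    by apply: msize1_polyC; rewrite msizeE; apply/bigmax_leqP_seq => m _ _;
      rewrite mdegE big_ord0.
  rewrite mmapC; have [->|c0] := eqVneq F@_0%MM 0; first by rewrite mpolyC0.
  move/(prime_idealMr (pC _ (leqnn _)) (f (F@_0%MM)^-1)).
  by rewrite -rmorphM mulVf // rmorph1 (negPf (prime_idealN1 (pC _ _))).
have rd' : (d - r.+1 < d)%N by lia.
have [bQ bP'] := bP _ rd'; have [sPQ _] := sC _ rd'.
have e : ((d - r.+1).+1 = d - r)%N by lia.
rewrite e in bQ sPQ.
apply: (@alg_indep_step r (fun i => b (d - i.+1)%N) _ (C (d - r)%N)) => //.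
- by apply: pC; lia.
- by apply: pC; lia.
- exact: IH (ltnW rd).
Qed.

End ChainIndependence.

(** * Algebraic dependence by counting monomials *)

Section AlgebraicDependence.
Variables (k : fieldType) (m : nat).

(** For a nonzero polynomial [msize] is the degree plus one, so the successors here bound degrees by
    [d], [e] and [d + e]. *)
Lemma leq_msizeM (p q : {mpoly k[m]}) d e :
  (msize p <= d.+1)%N -> (msize q <= e.+1)%N -> (msize (p * q) <= (d + e).+1)%N.
Proof.
have [->|p0] := eqVneq p 0; first by rewrite mul0r msize0.
have [->|q0] := eqVneq q 0; first by rewrite mulr0 msize0.
by rewrite msizeM // (mpolySpred _ p0) (mpolySpred _ q0); lia.
Qed.

Lemma leq_msize_mmap1 r (a : 'I_r -> {mpoly k[m]}) d (g : 'X_{1..r}) :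
  (forall i, msize (a i) <= d.+1)%N ->
  (msize (mmap1 a g) <= (mdeg g * d).+1)%N.
Proof.
move=> ad; rewrite mdegE big_distrl /=.
apply: (big_ind2 (fun p e => msize p <= e.+1)%N) => [|p d1 q d2|i _].
- by rewrite msize1.
- exact: leq_msizeM.
- elim: (g i) => [|n IH]; first by rewrite expr0 msize1.
  by rewrite exprS mulSn; apply: leq_msizeM.
Qed.

(* Counting: the monomials of exponents [< N] in [a] number [N ^ r], and their
   values have exponents [< E * N], where [(E * N) ^ m < N ^ r]. *)
Lemma alg_dependent r (a : 'I_r -> {mpoly k[m]}) : (m < r)%N ->
  exists2 F : {mpoly k[r]}, F != 0 & mmap (@mpolyC m k) a F = 0.
Proof.
move=> mr; pose d := \max_i msize (a i); pose E := (r * d).+1.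
(* As [N] exceeds [E ^ m], the product [E ^ m * N ^ m] is below [N ^ m.+1], hence below [N ^ r]. *)
pose N := (E ^ m).+1; pose M := (E * N)%N.
pose mon n K (g : {ffun 'I_n -> 'I_K}) := [multinom (g i : nat) | i < n].
have mon_inj n K : injective (@mon n K).
  move=> g h /mnmP gh; apply/ffunP => i; apply: val_inj.
  by have := gh i; rewrite !mnmE.
pose A := \matrix_(i < #|{ffun 'I_r -> 'I_N}|, j < #|{ffun 'I_m -> 'I_M}|)
  (mmap1 a (mon _ _ (enum_val i)))@_(mon _ _ (enum_val j)).
(* [A] has more rows than columns, so its rows satisfy a nontrivial linear relation, whose
   coefficients define [F]. *)
have /rowV0Pn[v /sub_kermxP vA v0] : kermx A != 0.
  rewrite -mxrank_eq0 mxrank_ker -lt0n subn_gt0.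
  apply: leq_ltn_trans (rank_leq_col _) _; rewrite !card_ffun !card_ord.
  apply: (@leq_trans (N ^ m.+1)); last by rewrite leq_pexp2l.
  by rewrite expnMn expnS ltn_pmul2r // expn_gt0.
pose F : {mpoly k[r]} := \sum_i v 0 i *: 'X_[mon _ _ (enum_val i)].
exists F.
  apply: contraNneq v0 => F0; apply/eqP/rowP => i; rewrite mxE.
  have := congr1 (mcoeff (mon _ _ (enum_val i))) F0.
  rewrite mcoeff0 raddf_sum (bigD1 i) //= mcoeffZ mcoeffX eqxx mulr1 big1 ?addr0 //.
  move=> j ji; rewrite mcoeffZ mcoeffX; case: eqP => [/mon_inj/enum_val_inj ij|].
    by rewrite ij eqxx in ji.
  by rewrite mulr0.
apply/mpolyP => g; rewrite mcoeff0 [mmap _ _ _]raddf_sum [LHS]raddf_sum /=.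
under eq_bigr do rewrite mmapZ mmapX mul_mpolyC mcoeffZ.
have [/forallP gM|gM] := boolP [forall j, g j < M]%N.
  pose h := [ffun j => Ordinal (gM j)].
  have := congr1 (fun B : 'rV_ _ => B 0 (enum_rank h)) vA.
  rewrite !mxE => {2}<-; apply: eq_bigr => i _; rewrite mxE enum_rankK.
  by congr (_ * _@__); apply/mnmP => j; rewrite mnmE ffunE.
(* An exponent of at least [M] forces degree at least [M], while the values have degree at most
   [r * N * d], which is less than [M = (r * d).+1 * N]. *)
apply: big1 => i _; rewrite memN_msupp_eq0 ?mulr0 //.
apply: msize_mdeg_ge; move: gM; rewrite negb_forall => /existsP[j].
rewrite -leqNgt => Mg.
have gg : (g j <= mdeg g)%N by rewrite mdegE (bigD1 j) //= leq_addr.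
apply: leq_trans (leq_trans Mg gg).
apply: leq_trans (@leq_msize_mmap1 _ _ d _ _) _ => [l|].
  exact/leqW/leq_bigmax.
have : (mdeg (mon _ _ (enum_val i)) <= r * N)%N.
  rewrite mdegE -[X in (_ <= X * _)%N](card_ord r) -sum_nat_const leq_sum // => l _.
  by rewrite mnmE ltnW.
rewrite /M /E => /leq_mul/(_ (leqnn d)) le_rN.
by apply: (@leq_ltn_trans (r * N * d)) => //; rewrite mulSn mulnAC; lia.
Qed.

Lemma leq_prime_chain d (C : nat -> {pred {mpoly k[m]}}) :
  prime_chain d C -> (d <= m)%N.
Proof.
move=> chC; have [a indep] := prime_chain_alg_indep (@mpolyC m k) chC.
rewrite leqNgt; apply/negP => /(alg_dependent (fun i => a i))[F /eqP F0 Fa].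
by apply/F0/indep; rewrite Fa; apply: prime_ideal0; case: chC => pC _; exact: pC.
Qed.

End AlgebraicDependence.

(** * Generated ideals, primes generated by variables, and heights *)

Lemma ideal_gen_sub (R : comNzRingType) (G : R -> Prop) (P : {pred R}) :
  prime_ideal P -> (forall f, G f -> f \in P) -> {subset ideal_gen G <= P}.
Proof.
move=> pP GP _ /ideal_genP[s [Gs ->]]; rewrite big_seq.
elim/big_ind: _ => [|u v|p /Gs/GP]; first exact: prime_ideal0.
  exact: prime_idealD.
exact: prime_idealMr.
Qed.

Lemma mem_ideal_gen (R : comNzRingType) (G : R -> Prop) f :
  G f -> f \in ideal_gen G.
Proof.
move=> Gf; apply/ideal_genP; exists [:: (1, f)]; rewrite big_seq1 mul1r.
by split=> // p; rewrite inE => /eqP->.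
Qed.

Section VariableIdeals.
Variables (k : fieldType) (m : nat).
Implicit Types (s t : seq 'I_m) (P I : {pred {mpoly k[m]}}).

Definition kill_vars s : {mpoly k[m]} -> {mpoly k[m]} :=
  mmap (@mpolyC m k) (fun i => if i \in s then 0 else 'X_i).
HB.instance Definition _ s := GRing.RMorphism.on (kill_vars s).

(** The ideal generated by the variables of [s], taken as the kernel of an endomorphism of a domain,
    which makes it visibly prime. *)
Definition var_ideal s : {pred {mpoly k[m]}} := [pred f | kill_vars s f == 0].

Lemma kill_varsX s i : kill_vars s 'X_i = if i \in s then 0 else 'X_i.
Proof. by rewrite /kill_vars mmapX mmap1U. Qed.

Lemma kill_varsC s c : kill_vars s c%:MP = c%:MP.
Proof. by rewrite /kill_vars mmapC. Qed.

Lemma mpoly_rmorph_eq (S : comNzRingType)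
    (g1 g2 : {rmorphism {mpoly k[m]} -> S}) :
  (forall c, g1 c%:MP = g2 c%:MP) -> (forall i, g1 'X_i = g2 'X_i) -> g1 =1 g2.
Proof.
move=> eqC eqX f; rewrite [f]mpolyE !rmorph_sum; apply: eq_bigr => g _ /=.
rewrite -mul_mpolyC !rmorphM /= eqC mpolyXE_id !rmorph_prod; congr (_ * _).
by apply: eq_bigr => i _ /=; rewrite !rmorphXn /= eqX.
Qed.

Lemma var_idealX s i : ('X_i \in var_ideal s) = (i \in s).
Proof.
rewrite inE kill_varsX; case: ifP => _; first exact: eqxx.
by apply/eqP => /(congr1 (mcoeff U_(i))) /eqP; rewrite mcoeffX eqxx mcoeff0 oner_eq0.
Qed.

Lemma var_ideal_prime s : prime_ideal (var_ideal s).
Proof.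
split=> [|f g]; last by rewrite !inE rmorphM mulf_eq0.
split=> [||a f g]; rewrite !inE ?rmorph0 ?rmorph1 ?oner_eq0 //.
by rewrite rmorphD rmorphM /= => /eqP-> /eqP->; rewrite mulr0 addr0.
Qed.

(** Setting the variables of [s] to zero beforehand does not change the effect of [kill_vars t]. *)
Lemma var_idealS s t : {subset s <= t} -> {subset var_ideal s <= var_ideal t}.
Proof.
move=> st f; rewrite !inE => /eqP f0.
suff /(_ f) /= <- : kill_vars t \o kill_vars s =1 kill_vars t.
  by rewrite f0 rmorph0.
apply: mpoly_rmorph_eq => [c|i] /=; first by rewrite !kill_varsC.
rewrite (kill_varsX s); case: ifP => // /st it.
by rewrite rmorph0 kill_varsX it.
Qed.

(** Modulo [P] every [f] is congruent to [kill_vars s f]: this holds for constants and variables,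
    and passes to sums and products. *)
Lemma var_ideal_minimal s P : prime_ideal P ->
  (forall i, i \in s -> 'X_i \in P) -> {subset var_ideal s <= P}.
Proof.
move=> pP sP f; rewrite inE => /eqP f0.
suff : f - kill_vars s f \in P by rewrite f0 subr0.
rewrite {f0} [f]mpolyE rmorph_sum /=.
apply: (big_ind2 (fun u v => u - v \in P)) => [|u1 v1 u2 v2 P1 P2|g _].
- by rewrite subrr prime_ideal0.
- by rewrite opprD addrACA prime_idealD.
rewrite -mul_mpolyC rmorphM /= kill_varsC -mulrBr prime_idealMr //.
rewrite mpolyXE_id rmorph_prod.
have PM u1 v1 u2 v2 : u1 - v1 \in P -> u2 - v2 \in P -> u1 * u2 - v1 * v2 \in P.
  move=> P1 P2; have -> : u1 * u2 - v1 * v2 = u1 * (u2 - v2) + v2 * (u1 - v1).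
    by ring.
  by apply: prime_idealD => //; exact: prime_idealMr.
apply: (big_ind2 (fun u v => u - v \in P)) => [|//|i _] /=.
  by rewrite subrr prime_ideal0.
rewrite rmorphXn /=; elim: (g i) => [|n IH]; first by rewrite subrr prime_ideal0.
rewrite !exprS; apply: PM IH; rewrite kill_varsX.
by case: ifP => [/sP|_]; rewrite ?subr0 ?subrr ?prime_ideal0.
Qed.

(** Each step adjoins one variable, which is new because [s] has no repetition. The offset [j] is
    [0] for flags from the zero ideal, and positive for flags that start at a given variable
    prime. *)
Lemma flag_chain s j : uniq s -> (j <= size s)%N ->
  prime_chain (size s - j) (fun i => var_ideal (take (j + i) s)).
Proof.
move=> us js; split=> i ij; first exact: var_ideal_prime.
rewrite addnS; set l := (j + i)%N; have ls : (l < size s)%N by rewrite /l; lia.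
pose x := tnth (in_tuple s) (Ordinal ls).
rewrite (take_nth x ls); split=> [|sub].
  by apply: var_idealS => z zs; rewrite mem_rcons inE zs orbT.
have /sub : 'X_(nth x s l) \in var_ideal (rcons (take l s) (nth x s l)).
  by rewrite var_idealX mem_rcons mem_head.
rewrite var_idealX => /(nthP x)[n]; rewrite size_take ls => nl.
rewrite nth_take // => /eqP; rewrite nth_uniq // ?(ltn_trans nl) //.
by rewrite ltn_eqF.
Qed.

Lemma size_uniq_ord s : uniq s -> (size s <= m)%N.
Proof. by move=> us; rewrite -[leqRHS]card_ord -(card_uniqP us) max_card. Qed.

Lemma exists_full_extension s : uniq s ->
  exists t, [/\ uniq (s ++ t) & size (s ++ t) = m].
Proof.
move=> us; exists [seq i <- enum 'I_m | i \notin s].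
have ust : uniq (s ++ [seq i <- enum 'I_m | i \notin s]).
  rewrite cat_uniq us filter_uniq ?enum_uniq // andbT.
  by apply/hasPn => i; rewrite mem_filter => /andP[].
split=> //; rewrite -(card_uniqP ust) -[RHS]card_ord; apply: eq_card => i.
by rewrite mem_cat mem_filter mem_enum andbT orbN.
Qed.

Lemma var_ideal_upper_chain s : uniq s ->
  exists C, prime_chain (m - size s) C /\ C 0%N = var_ideal s.
Proof.
move=> /[dup] us /exists_full_extension[t [ust st]].
exists (fun i => var_ideal (take (size s + i) (s ++ t))); split.
  have := @flag_chain (s ++ t) (size s) ust.
  by rewrite st; apply; rewrite -{2}st size_cat leq_addr.
by rewrite addn0 take_size_cat.
Qed.

(** The flag of [s] rises from the zero ideal to [var_ideal s]; by minimality [C 0] contains that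
    last prime, and takes its place. *)
Lemma prepend_flag s d (C : nat -> {pred {mpoly k[m]}}) :
  uniq s -> (forall i, i \in s -> 'X_i \in C 0%N) -> prime_chain d C ->
  exists2 C', prime_chain (size s + d) C' & C' (size s + d)%N = C d.
Proof.
move=> us sC chC; exists (cat_chain (size s) (fun i => var_ideal (take i s)) C).
  apply: cat_chainP => //; first by have := flag_chain us (leq0n _); rewrite subn0.
  by rewrite take_size; apply: var_ideal_minimal sC; case: chC => pC _; exact: pC.
exact: cat_chain_last.
Qed.

(** The flag of [s] gives the lower bound. Conversely, a chain of length [h] ending here extends
    upwards by [m - size s] steps, and the total length is at most [m]. *)
Lemma var_ideal_height s : uniq s -> prime_height (var_ideal s) (size s).
Proof.
move=> us; split=> [|h C chC Cs].
  exists (fun i => var_ideal (take i s)); split; last by rewrite take_size.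
  by have := flag_chain us (leq0n _); rewrite subn0.
have [C' [chC' C'0]] := var_ideal_upper_chain us.
have /leq_prime_chain : prime_chain (h + (m - size s)) (cat_chain h C C').
  by apply: cat_chainP => //; rewrite C'0 => f; rewrite Cs.
by have := size_uniq_ord us; lia.
Qed.

(** [var_ideal s] attains the minimum: any prime over [I] ends a chain of length [size s], namely a
    flag of variables it contains with the prime itself as last term. *)
Lemma ideal_height_vars I s : uniq s -> {subset I <= var_ideal s} ->
    (forall P, prime_ideal P -> {subset I <= P} ->
       exists t, [/\ uniq t, size t = size s & forall i, i \in t -> 'X_i \in P]) ->
  ideal_height I (size s).
Proof.
move=> us Is IP; split=> [|P h pP IsP [_ hP]].
  exists (var_ideal s); split=> //; first exact: var_ideal_prime.
  exact: var_ideal_height.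
have [t [ut <- tP]] := IP _ pP IsP.
have [C chC CP] := prepend_flag ut tP (prime_chain0 pP).
by move: CP chC; rewrite addn0 => CP chC; apply: hP chC _ => f; rewrite CP.
Qed.

End VariableIdeals.

(** * Primes of a quotient ring, and its dimension *)

Local Open Scope quotient_scope.

Section Quotient.
Variables (R : comNzRingType) (I : idealr R).
Local Notation Q := {ideal_quot I}.
Local Notation quo := (\pi_Q : R -> Q).

Lemma quo_repr (q : Q) : quo (repr q) = q. Proof. exact: reprK. Qed.

Lemma quo_eq (f g : R) : quo f = quo g <-> f - g \in I.
Proof. by rewrite Quotient.idealrBE; split=> /eqP. Qed.

Lemma prime_preim (P : {pred Q}) :
  prime_ideal P -> prime_ideal [pred f | quo f \in P].
Proof.
case=> -[P0 P1 Pl] Pp; split=> [|f g]; last by rewrite !inE rmorphM; apply: Pp.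
split=> [||a f g]; rewrite !inE ?rmorph0 ?rmorph1 //.
by rewrite rmorphD rmorphM; apply: Pl.
Qed.

(** A prime containing [I] is a union of classes modulo [I], so the choice made by [repr] does not
    matter. *)
Lemma mem_repr_quo (P : {pred R}) f : prime_ideal P -> {subset I <= P} ->
  (repr (quo f) \in P) = (f \in P).
Proof.
move=> pP IP; have /quo_eq/IP d : quo f = quo (repr (quo f)) by rewrite quo_repr.
by rewrite -[in RHS](subrK (repr (quo f)) f) addrC prime_idealDr.
Qed.

Lemma prime_image (P : {pred R}) : prime_ideal P -> {subset I <= P} ->
  prime_ideal [pred q : Q | repr q \in P].
Proof.
move=> pP IP; have reprE := mem_repr_quo _ pP IP.
have [[P0 P1 Pl] Pp] := pP.
split=> [|u v]; last first.
  rewrite -[u]quo_repr -[v]quo_repr !inE -rmorphM !reprE; exact: Pp.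
split=> [||a u v].
- by rewrite inE -(rmorph0 quo) reprE.
- by rewrite inE -(rmorph1 quo) reprE.
- rewrite -[a]quo_repr -[u]quo_repr -[v]quo_repr !inE -rmorphM -rmorphD !reprE.
  exact: Pl.
Qed.

Lemma quo_chain d (C : nat -> {pred R}) : prime_chain d C ->
  {subset I <= C 0%N} ->
  prime_chain d (fun i => [pred q : Q | repr q \in C i]).
Proof.
move=> [pC sC] IC0.
have IC i : (i <= d)%N -> {subset I <= C i}.
  elim: i => // i IH id f /(IH (ltnW id)); exact: (sC _ id).1.
split=> i id; first by apply: prime_image (IC _ id); exact: pC.
have [sub nsub] := sC _ id; split=> [q|sub']; first exact: sub.
apply: nsub => f fC; rewrite -(mem_repr_quo _ (pC _ (ltnW id)) (IC _ (ltnW id))).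
by apply: (sub' (quo f)); rewrite inE mem_repr_quo //; [exact: pC|exact: IC].
Qed.

Lemma preim_chain d (C : nat -> {pred Q}) : prime_chain d C ->
  prime_chain d (fun i => [pred f | quo f \in C i]).
Proof.
move=> [pC sC]; split=> i id; first exact/prime_preim/pC.
have [sub nsub] := sC _ id; split=> [f|sub']; first exact: sub.
by apply: nsub => q; rewrite -[q]quo_repr => /sub'.
Qed.

End Quotient.

(** A chain from [var_ideal s] upwards descends to the quotient. Conversely, a chain of the quotient
    pulls back to primes over [I], below which [size s] steps fit, and [leq_prime_chain] bounds the
    total. *)
Lemma krull_dim_vars (k : fieldType) m (I : idealr {mpoly k[m]}) (s : seq 'I_m) :
    uniq s -> {subset I <= var_ideal s} ->
    (forall P : {pred {mpoly k[m]}}, prime_ideal P -> {subset I <= P} ->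
       exists t, [/\ uniq t, size t = size s & forall i, i \in t -> 'X_i \in P]) ->
  krull_dim {ideal_quot I} (m - size s).
Proof.
move=> us Is IP; split=> [|d C /preim_chain].
  have [C [chC C0]] := var_ideal_upper_chain k us.
  by eexists; apply: (quo_chain chC); rewrite C0.
set C' := (fun i => _) => chC.
have pC0 : prime_ideal (C' 0%N) by case: chC => pC _; exact: pC.
have [|t [ut st tP]] := IP _ pC0.
  (* Elements of [I] have class zero, which lies in every prime of the quotient. *)
  move=> f fI; have := prime_ideal0 pC0; rewrite !inE.
  by have /quo_eq-> : f - 0 \in I by rewrite subr0.
have [C'' /leq_prime_chain] := prepend_flag ut tP chC.
by rewrite st; lia.
Qed.

(** * Ranks and saturated chains in the grid *)

Section Grid.
Variable n : nat.
Implicit Types (u v w : L2 n) (s t : seq (L2 n)).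

Definition rank v : nat := (v.1 + v.2)%N.

Lemma covers_lt_rank u v : covers u v -> (rank u < rank v)%N.
Proof. by rewrite L2_coversE /rank -!val_eqE /=; lia. Qed.

Lemma sorted_rank s : saturated_chain s -> sorted ltn (map rank s).
Proof. by rewrite sorted_map; apply: sub_sorted => u v; exact: covers_lt_rank. Qed.

Lemma uniq_rank s : saturated_chain s -> uniq (map rank s).
Proof. by move/sorted_rank; apply: sorted_uniq; [exact: ltn_trans|exact: ltnn]. Qed.

Lemma rank_iota s : {subset map rank s <= iota 0 n.+1}.
Proof.
move=> _ /mapP[[i j] _ ->]; rewrite mem_iota /= /rank /=.
by have := ltn_ord i; have := ltn_ord j; lia.
Qed.

(** The ranks along a chain are distinct and range over [0, ..., n]. *)
Lemma size_saturated_chain s : saturated_chain s -> (size s <= n.+1)%N.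
Proof.
move=> /uniq_rank us; rewrite -(size_map rank) -(size_iota 0 n.+1).
by apply: uniq_leq_size us _; exact: rank_iota.
Qed.

Lemma maximal_of_size s :
  saturated_chain s -> size s = n.+1 -> maximal_saturated_chain s.
Proof.
move=> ss sz; split=> // t st sub.
have [|_ e v] := uniq_min_size (map_uniq (uniq_rank ss)) sub; last by rewrite e.
by rewrite sz size_saturated_chain.
Qed.

(** [n.+1] distinct ranks among [0, ..., n] exhaust these values. *)
Lemma rank0_mem s : saturated_chain s -> size s = n.+1 ->
  exists2 v, v \in s & rank v = 0%N.
Proof.
move=> /uniq_rank us sz.
have [|_ e] := uniq_min_size us (@rank_iota s).
  by rewrite size_map sz size_iota.
have : 0%N \in map rank s by rewrite e mem_iota.
by case/mapP => v vs v0; exists v.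
Qed.

Lemma mem_chain_edges s u v :
  (u, v) \in chain_edges s -> u \in s /\ v \in behead s.
Proof.
case: s => [|a s] //=; rewrite /chain_edges /=.
elim: s a => [|b s IH] a //=; rewrite inE => /orP[/eqP[-> ->]|/IH[us vs]].
  by rewrite !mem_head.
by rewrite inE us orbT inE vs orbT.
Qed.

Lemma row_saturated (i : 'I_2) :
  saturated_chain [seq (i, j) : L2 n | j <- enum 'I_n].
Proof.
rewrite /saturated_chain sorted_map.
have : sorted (fun a b => b == a.+1) (map val (enum 'I_n)).
  by rewrite val_enum_ord; elim: n 0%N => [|[|r] IH] a //=; rewrite eqxx; exact: IH.
rewrite sorted_map; apply: sub_sorted => a b /= ab.
by rewrite L2_coversE /= eqxx ab.
Qed.

End Grid.

(** * The two bottom edges, and two edge-disjoint maximal chains *)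

Section NontrivialGrid.
Variable n : nat.
Local Notation L := (L2 n.+2).

Definition bot2 : L := (ord0, ord0).
Definition right2 : L := (ord0, inord 1).
Definition up2 : L := (ord_max, ord0).

Lemma covers_right2 : covers bot2 right2.
Proof. by rewrite L2_coversE /= inordK. Qed.

Lemma covers_up2 : covers bot2 up2.
Proof. by rewrite L2_coversE /=. Qed.

Lemma covers_bot2 v : covers bot2 v -> v = right2 \/ v = up2.
Proof.
rewrite L2_coversE; case: v => i j /= /orP[/andP[/eqP<- /eqP j1]|/andP[/eqP i1 /eqP<-]].
  by left; congr pair; apply: val_inj; rewrite /= inordK.
by right; congr pair; apply: val_inj.
Qed.

Lemma rank0_bot2 (v : L) : rank v = 0%N -> v = bot2.
Proof. by case: v => i j; rewrite /rank /= => ?; congr pair; apply: val_inj => /=; lia. Qed.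

Lemma exists_covered (v : L) : v != bot2 -> exists u, covers u v.
Proof.
case: v => i j; have [j0|j0] := posnP j.
  rewrite xpair_eqE -!val_eqE /= j0 => i0; exists (ord0, j).
  by rewrite L2_coversE /= eqxx -!val_eqE /=; have := ltn_ord i; lia.
move=> _; exists (i, inord j.-1); rewrite L2_coversE /= eqxx.
by rewrite inordK; have := ltn_ord j; lia.
Qed.

(** Any other chain can be enlarged: the empty one by [bot2], one with another head by an element
    which that head covers, and the singleton of [bot2] by [right2]. *)
Lemma maximal_chain_bottom_edge (s : seq L) : maximal_saturated_chain s ->
  (bot2, right2) \in chain_edges s \/ (bot2, up2) \in chain_edges s.
Proof.
case: s => [|a s] [sat max].
  have sub0 : {subset [::] <= [:: bot2]} by [].
  by have := max [:: bot2] isT sub0 _ (mem_head _ _).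
have a0 : a = bot2.
  apply/eqP; apply/negPn/negP => /exists_covered[b ba].
  have sat' : saturated_chain [:: b, a & s] by rewrite /saturated_chain /= ba.
  have sub' : {subset a :: s <= [:: b, a & s]} by move=> v vs; rewrite inE vs orbT.
  (* By maximality [b] already occurs in the chain, so its rank would be repeated in the longer
     one. *)
  have /(map_f (@rank _)) := max _ sat' sub' b (mem_head _ _).
  by have /= /andP[/negP] := uniq_rank sat'.
case: s sat max => [|b s] sat max; subst a.
  have sat' : saturated_chain [:: bot2; right2].
    by rewrite /saturated_chain /= covers_right2.
  have sub' : {subset [:: bot2] <= [:: bot2; right2]}.
    by move=> v; rewrite inE => /eqP->; rewrite mem_head.
  have : right2 \in [:: bot2] by apply: (max _ sat' sub'); rewrite !inE eqxx orbT.
  by rewrite inE xpair_eqE -!val_eqE /= inordK.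
have /andP[/covers_bot2 b0 _] := sat.
by case: b0 => ->; [left|right]; rewrite /chain_edges /= mem_head.
Qed.

(** This chain moves to the top row at its first step, [lower_chain] at its last. *)
Definition upper_chain : seq L :=
  bot2 :: [seq (ord_max, j) | j <- enum 'I_n.+2].

Definition lower_chain : seq L :=
  rcons [seq (ord0, j) | j <- enum 'I_n.+2] (ord_max, ord_max).

Lemma size_upper_chain : size upper_chain = n.+3.
Proof. by rewrite /= size_map size_enum_ord. Qed.

Lemma size_lower_chain : size lower_chain = n.+3.
Proof. by rewrite size_rcons size_map size_enum_ord. Qed.

Lemma upper_chain_saturated : saturated_chain upper_chain.
Proof.
have := row_saturated n.+2 ord_max.
by rewrite /saturated_chain /= !enum_ordSl /= covers_up2.
Qed.

Lemma lower_chain_saturated : saturated_chain lower_chain.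
Proof.
have := row_saturated n.+2 ord0; rewrite /saturated_chain /lower_chain.
have : last bot2 [seq (ord0, j) : L | j <- enum 'I_n.+2] = (ord0, ord_max).
  by rewrite enum_ordSr map_rcons last_rcons.
(* The empty list is impossible: its [last] would be the default [bot2], whose second coordinate is
   not maximal. *)
case: map => [|a s] /=; first by move=> /(congr1 (fun v : L => val v.2)).
by rewrite rcons_path => -> ->; rewrite L2_coversE /=.
Qed.

(** The two chains share only the bottom and the top element, and no edge joins these, as the long
    factor has at least two elements. *)
Lemma disjoint_chains u v :
  covers u v -> (u, v) \in chain_edges upper_chain ->
  (u, v) \notin chain_edges lower_chain.
Proof.
move=> uv /mem_chain_edges[uU vU]; apply/negP => /mem_chain_edges[uL /mem_behead vL].
move: uv; rewrite L2_coversE.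
have v1 : v.1 = ord_max by case/mapP: vU => j _ ->.
have {uU} : u = bot2 \/ u.1 = ord_max.
  by move: uU; rewrite inE => /orP[/eqP|/mapP[j _ ->]]; [left|right].
have low w : w \in lower_chain -> w.1 = ord0 \/ w = (ord_max, ord_max).
  by rewrite mem_rcons inE => /orP[/eqP|/mapP[j _ ->]]; [right|left].
case/low: vL => [|->]; first by rewrite v1.
case => [->|u1] //=.
by case/low: uL => [|->] /=; [rewrite u1|lia].
Qed.

End NontrivialGrid.

Lemma var_ideal_prod (k : fieldType) m (s : seq 'I_m) (I : finType)
    (A : pred I) (g : I -> 'I_m) i0 :
  A i0 -> g i0 \in s ->
  \prod_(i | A i) 'X_(g i) \in (var_ideal s : {pred {mpoly k[m]}}).
Proof.
move=> Ai0 gs; rewrite (bigD1 i0) //= mulrC.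
by apply/(prime_idealMr (var_ideal_prime _ _)); rewrite var_idealX.
Qed.

(** * Variables in the primes over the two ideals *)

Section GridIdeals.
Variables (k : fieldType) (n : nat).
Local Notation L := (L2 n.+2).

Lemma path_ideal_sub m (x : L -> 'I_m) :
  {subset path_ideal k n.+3 x <= var_ideal [:: x (bot2 n)]}.
Proof.
apply: ideal_gen_sub => [|_ [s [sat sz ->]]]; first exact: var_ideal_prime.
have [v vs /rank0_bot2 v0] := rank0_mem sat sz.
by apply: (var_ideal_prod _ vs); rewrite v0 mem_head.
Qed.

Lemma prime_over_path_ideal m (x : L -> 'I_m) (P : {pred {mpoly k[m]}}) :
  prime_ideal P -> {subset path_ideal k n.+3 x <= P} ->
  exists t, [/\ uniq t, size t = 1%N & forall i, i \in t -> 'X_i \in P].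
Proof.
move=> pP IP; have [|v _ vP] := prime_ideal_prod pP (A := mem (upper_chain n))
    (F := fun v => 'X_(x v)).
  apply: IP; apply: mem_ideal_gen; exists (upper_chain n).
  by split; [exact: upper_chain_saturated|exact: size_upper_chain|].
by exists [:: x v]; split=> // i; rewrite inE => /eqP->.
Qed.

Definition right_edge : edge L := exist _ (bot2 n, right2 n) (covers_right2 n).
Definition up_edge : edge L := exist _ (bot2 n, up2 n) (covers_up2 n).

Lemma right_up_edge : right_edge != up_edge.
Proof. by apply/eqP => /(congr1 (fun e : edge L => val (val e).2.1)). Qed.

Lemma ideal_LD_sub m (y : edge L -> 'I_m) :
  {subset ideal_LD k y <= var_ideal [:: y right_edge; y up_edge]}.
Proof.
apply: ideal_gen_sub => [|_ [s [max ->]]]; first exact: var_ideal_prime.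
case: (maximal_chain_bottom_edge max) => es.
  by apply: (@var_ideal_prod _ _ _ _ _ _ right_edge); rewrite // !inE eqxx.
by apply: (@var_ideal_prod _ _ _ _ _ _ up_edge); rewrite // !inE eqxx orbT.
Qed.

(** The prime contains a variable from the monomial of each of the two edge-disjoint chains;
    injectivity of [y] keeps these variables distinct. *)
Lemma prime_over_ideal_LD m (y : edge L -> 'I_m) (P : {pred {mpoly k[m]}}) :
  injective y -> prime_ideal P -> {subset ideal_LD k y <= P} ->
  exists t, [/\ uniq t, size t = 2%N & forall i, i \in t -> 'X_i \in P].
Proof.
move=> yinj pP IP.
have edgeP s : saturated_chain s -> size s = n.+3 ->
    exists2 e : edge L, val e \in chain_edges s & 'X_(y e) \in P.
  move=> sat sz; apply: (prime_ideal_prod pP); apply/IP/mem_ideal_gen.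
  by exists s; split=> //; exact: maximal_of_size.
have [e eU eP] := edgeP _ (upper_chain_saturated n) (size_upper_chain n).
have [e' eL eP'] := edgeP _ (lower_chain_saturated n) (size_lower_chain n).
exists [:: y e; y e']; split=> [|//|i]; last first.
  by rewrite !inE => /orP[]/eqP->.
rewrite /= andbT inE inj_eq //; apply: contraTN eL => /eqP<-.
case: e eU {eP} => -[u v] /= uv; exact: disjoint_chains.
Qed.

End GridIdeals.

(* MathComp world; x and y are arbitrary identifications of the elements and
   of the edges of L_{2,n} with the variables x_1, ..., x_{2n} and
   y_1, ..., y_{3n-2}. *)
Theorem lemma5p17 (n : nat) (hn : (1 < n)%N) (k : fieldType)
    (x : L2 n -> 'I_(2 * n)) (hx : bijective x)
    (y : edge (L2 n) -> 'I_(3 * n - 2)) (hy : bijective y) :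
  (ideal_height (ideal_LD k y) 2 /\
   ideal_height (path_ideal k n.+1 x) 1) /\
  (krull_dim {ideal_quot (ideal_gen_idealr (ideal_LD_proper k y hn))}
     (3 * n - 4) /\
   krull_dim {ideal_quot (ideal_gen_idealr (path_ideal_proper k x))}
     (2 * n - 1)).
Proof.
case: n hn x hx y hy => [|[|n]] // hn x hx y /bij_inj yinj.
have uy : uniq [:: y (right_edge n); y (up_edge n)].
  by rewrite /= andbT inE inj_eq // right_up_edge.
have -> : (3 * n.+2 - 4 = 3 * n.+2 - 2 - 2)%N by lia.
split; split.
- exact: (ideal_height_vars uy (@ideal_LD_sub k n _ y)
    (fun P => @prime_over_ideal_LD k n _ y P yinj)).
- exact: (@ideal_height_vars k _ _ [:: x (bot2 n)] isT (@path_ideal_sub k n _ x)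
    (@prime_over_path_ideal k n _ x)).
- exact: (@krull_dim_vars k _ (ideal_gen_idealr (ideal_LD_proper k y hn)) _
    uy (@ideal_LD_sub k n _ y) (fun P => @prime_over_ideal_LD k n _ y P yinj)).
- exact: (@krull_dim_vars k _ (ideal_gen_idealr (path_ideal_proper k x))
    [:: x (bot2 n)] isT (@path_ideal_sub k n _ x)
    (@prime_over_path_ideal k n _ x)).
Qed.
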